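(* Let $p>3$ be a prime and $r\ge1$ an integer. Then $$\sum_{k=0}^{(p^r-1)/2}(4k+1)\frac{(\frac12)_k^4}{(1)_k^4}\equiv p^r+\frac76p^{r+3}B_{p-3}\pmod{p^{r+4}}.$$
   Context: $(x)_k=x(x+1)\cdots(x+k-1)$ is the Pochhammer symbol, with $(x)_0=1$. $B_0,B_1,B_2,\dots$ are the Bernoulli numbers. A congruence $a\equiv b\pmod{p^m}$ between rational numbers means that $(a-b)/p^m$ is a rational number whose denominator is not divisible by $p$. *)

(* Defs.v *)
From mathcomp Require Import all_boot all_order all_algebra.
Set Implicit Arguments. Unset Strict Implicit. Unset Printing Implicit Defensive.
Import Order.TTheory GRing.Theory Num.Theory.
Local Open Scope ring_scope.

Definition pochhammer (x : rat) (k : nat) : rat := \prod_(i < k) (x + i%:R).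

(* Bernoulli numbers via B_0 = 1, sum_{k=0}^{n} C(n+1,k) B_k = 0 (n >= 1),
   i.e. B_n = -1/(n+1) * sum_{k<n} C(n+1,k) B_k  (so B_1 = -1/2). *)
Fixpoint bern_seq (n : nat) : seq rat :=
  match n with
  | 0 => [:: 1]
  | n'.+1 => let s := bern_seq n' in
      rcons s (- (n'.+2%:R)^-1 *
               \sum_(k < n'.+1) ('C(n'.+2, k))%:R * nth 0 s k)
  end.

Definition bernoulli (n : nat) : rat := nth 0 (bern_seq n) n.

Definition rat_cong (a b : rat) (p m : nat) : Prop :=
  ~~ (p %| `|denq ((a - b) / (p ^ m)%:R)|)%N.

(* Main.v *)
(** Write n = p^r = 2N+1 and c_k = (1/2)_k/k!.  The sum has an exact evaluation,
    sum_(k <= N) (4k+1) c_k^4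
      = 2 n^2 c_N^2 sum_(d odd, d <= n) c_((n-d)/2) c_((n+d)/2) / d,
    provable by creative telescoping in N.  Expressing every quantity on the right
    through the ratios n/j with 0 < j < n, all divisible by p, the term d = n gives
    n prod_j (1-u)^3(1+u)/(1-2u) with u = n/(2j), where
    (1-u)^3(1+u) = 1 - 2u + O(u^3), and the other terms are n times (n/d)^2 times a
    product of (1+x)/(1-x) with x = (-1)^j n/j, j < d.  Modulo n p^4 only the indices
    divisible by p^(r-1) survive, so everything reduces to harmonic sums below p:
      1 + 2 p^3 E_3 + 2 (p^2 O_2 - p^3 O_3 + 2 p^3 D),
    where E_k and O_k sum 1/j^k over even and odd j, and D sums (-1)^j/(j d^2) over
    j < d with d odd.  Reflection j -> p - j and doubling give O_3 = -E_3 (mod p),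
    3 O_2 = -p E_3 (mod p^2) and, through sum_j j^(p-3) = p B_(p-3) (mod p^2),
    B_(p-3) = -4 E_3 (mod p); reflection and a partial fraction identity give
    D = -2 E_3 (mod p). *)

From HB Require Import structures.
From mathcomp Require Import all_boot all_order all_algebra.
From mathcomp Require Import zify ring lra.
Require Import Defs.
Set Implicit Arguments. Unset Strict Implicit. Unset Printing Implicit Defensive.
Import Order.TTheory GRing.Theory Num.Theory.
Local Open Scope ring_scope.

(** * Congruences between p-integral rationals *)

(** For prime [p] this is the localisation of the integers at p. It is packaged as a qualifier so
    that its subring structure is available to the [rpred] lemmas. *)
Definition pint_pred (p : nat) (x : rat) := coprime p `|denq x|.
Arguments pint_pred p x /.
Definition pint (p : nat) := [qualify a x : rat | pint_pred p x].

(** The reduced denominator is coprime to the numerator, hence divides every b that clears x. Any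
    denominator prime to p therefore suffices, and closure proofs can simply multiply
    denominators. *)
Lemma pintP p (x : rat) :
  reflect (exists2 b : nat, (0 < b)%N && coprime p b & x * b%:R \is a Num.int)
          (x \is a pint p).
Proof.
apply: (iffP idP) => [px | [b /andP[b_gt0 pb] /intrP[a xb]]].
  exists `|denq x|%N; first by rewrite absz_gt0 denq_neq0.
  by rewrite -[_%:R]/(`|denq x|%N%:~R) absz_denq -numqE intr_int.
rewrite qualifE /=; apply: coprime_dvdr pb.
have : (denq x %| numq x * b)%Z.
  suff -> : numq x * b = a * denq x by rewrite dvdz_mull.
  apply: (@intr_inj rat); rewrite !intrM numqE -xb.
  by rewrite mulrAC.
rewrite Gauss_dvdzr; first by rewrite dvdzE.
by rewrite coprimezE coprime_sym coprime_num_den.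
Qed.

Fact pint_subring_closed p : subring_closed (pint p).
Proof.
split=> [|x y /pintP[b /andP[b0 pb] xb] /pintP[c /andP[c0 pc] yc]
         |x y /pintP[b /andP[b0 pb] xb] /pintP[c /andP[c0 pc] yc]].
- by apply/pintP; exists 1%N; rewrite ?coprimen1 ?mulr1 ?rpred1.
- apply/pintP; exists (b * c)%N; first by rewrite muln_gt0 b0 c0 coprimeMr pb.
  rewrite natrM; have -> : (x - y) * (b%:R * c%:R)
    = x * b%:R * c%:R - y * c%:R * b%:R by ring.
  by apply: rpredB; apply: rpredM; rewrite ?natr_int.
- apply/pintP; exists (b * c)%N; first by rewrite muln_gt0 b0 c0 coprimeMr pb.
  by rewrite natrM mulrACA rpredM.
Qed.
HB.instance Definition _ p :=
  GRing.isSubringClosed.Build rat (pint_pred p) (pint_subring_closed p).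

Lemma pintV_nat p b : (0 < b)%N -> coprime p b -> b%:R^-1 \is a pint p.
Proof.
move=> b0 pb; apply/pintP; exists b; rewrite ?b0 //.
by rewrite mulVf ?rpred1 // pnatr_eq0 -lt0n.
Qed.

Section PowerCongruence.
Variables (p : nat).
Hypothesis p_gt1 : (1 < p)%N.

Let p_neq0 : p%:R != 0 :> rat. Proof. by rewrite pnatr_eq0; lia. Qed.

(** For prime p: the p-adic valuation is at least m. The quotient form matches the [rat_cong] of the
    theorem. *)
Definition pdvd m (x : rat) := x / p%:R ^+ m \is a pint p.
Definition pcong m (x y : rat) := pdvd m (x - y).

Lemma pdvdP m x : reflect (exists2 z, z \is a pint p & x = p%:R ^+ m * z) (pdvd m x).
Proof.
have pm : p%:R ^+ m != 0 :> rat by rewrite expf_neq0.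
apply: (iffP idP) => [xm | [z zp ->]].
  by exists (x / p%:R ^+ m) => //; field.
by rewrite /pdvd mulrAC divff // mul1r.
Qed.

Lemma pdvd_exp m z : z \is a pint p -> pdvd m (p%:R ^+ m * z).
Proof. by move=> zp; apply/pdvdP; exists z. Qed.

Lemma pdvd0 x : pdvd 0 x = (x \is a pint p).
Proof. by rewrite /pdvd expr0 divr1. Qed.

Lemma pdvd_0 m : pdvd m 0.
Proof. by rewrite /pdvd mul0r rpred0. Qed.

Lemma pdvdD m x y : pdvd m x -> pdvd m y -> pdvd m (x + y).
Proof. by rewrite /pdvd mulrDl; apply: rpredD. Qed.

Lemma pdvdN m x : pdvd m (- x) = pdvd m x.
Proof. by rewrite /pdvd mulNr rpredN. Qed.

Lemma pdvdM m k x y : pdvd m x -> pdvd k y -> pdvd (m + k) (x * y).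
Proof. by rewrite /pdvd exprD invfM mulrACA; apply: rpredM. Qed.

Lemma pdvdMl m x y : x \is a pint p -> pdvd m y -> pdvd m (x * y).
Proof. by rewrite -pdvd0 -{2}[m]add0n; apply: pdvdM. Qed.

Lemma pdvdMr m x y : pdvd m x -> y \is a pint p -> pdvd m (x * y).
Proof. by rewrite mulrC => mx yp; apply: pdvdMl. Qed.

Lemma pdvdX m k x : pdvd m x -> pdvd (k * m) (x ^+ k).
Proof.
move=> mx; elim: k => [|k IH]; first by rewrite pdvd0 expr0 rpred1.
by rewrite mulSn exprS pdvdM.
Qed.

Lemma pdvdW m k x : (k <= m)%N -> pdvd m x -> pdvd k x.
Proof.
move=> /subnK <- /pdvdP[z zp ->].
by rewrite addnC exprD -mulrA pdvd_exp ?rpredM ?rpredX ?rpred_nat.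
Qed.

Lemma pdvd_pint m x : pdvd m x -> x \is a pint p.
Proof. by move/(@pdvdW m 0 x isT); rewrite pdvd0. Qed.

Lemma pdvd_sum (I : eqType) m (s : seq I) (P : pred I) (F : I -> rat) :
  (forall i, i \in s -> P i -> pdvd m (F i)) -> pdvd m (\sum_(i <- s | P i) F i).
Proof.
move=> FP; rewrite big_seq_cond; apply: (big_ind (pdvd m)) => [|x y|i /andP[]].
- exact: pdvd_0.
- exact: pdvdD.
- exact: FP.
Qed.

(** With y = p a / b, the number 1 + y equals (b + p a) / b, and b + p a is prime to p because b
    is. *)
Lemma pdvd1_unit y : pdvd 1 y -> 1 + y != 0 /\ (1 + y)^-1 \is a pint p.
Proof.
move=> /pdvdP[z /pintP[b /andP[b0 pb] /intrP[a za]] ->].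
pose g : int := b%:Z + p%:Z * a.
have gE : (1 + p%:R ^+ 1 * z) * b%:R = g%:~R.
  by rewrite rmorphD rmorphM /= -za expr1 mulrDl mul1r mulrA.
have pg : coprime p `|g|.
  rewrite -[p]absz_nat -coprimezE /coprimez /g mulrC addrC gcdzMDl.
  by rewrite -/(coprimez _ _) coprimezE.
have g0 : g != 0.
  by apply: contraTneq pg => ->; rewrite /coprime gcdn0; lia.
have gq : g%:~R != 0 :> rat by rewrite intr_eq0.
have y0 : 1 + p%:R ^+ 1 * z != 0.
  by move: gq; rewrite -gE mulf_eq0 negb_or => /andP[].
split=> //; apply/pintP; exists `|g|%N; first by rewrite absz_gt0 g0.
have -> : (1 + p%:R ^+ 1 * z)^-1 = b%:R / g%:~R.
  rewrite -gE; field; rewrite y0 andbT pnatr_eq0; lia.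
have [-> | ->] : `|g|%N%:R = g%:~R :> rat \/ `|g|%N%:R = - g%:~R :> rat.
  case: (g) => m; [left|right]; first by [].
  by rewrite NegzE abszN absz_nat /= rmorphN opprK.
- by rewrite divfK // rpred_nat.
- by rewrite mulrN divfK // rpredN rpred_nat.
Qed.

Lemma pcong_refl m x : pcong m x x.
Proof. by rewrite /pcong subrr pdvd_0. Qed.

Lemma eq_pcong m x y : x = y -> pcong m x y.
Proof. by move=> ->; apply: pcong_refl. Qed.

Lemma pcong_trans m y x z : pcong m x y -> pcong m y z -> pcong m x z.
Proof. by move=> /pdvdD xy /xy; rewrite addrA subrK. Qed.

Lemma pcongD m x y x' y' : pcong m x x' -> pcong m y y' -> pcong m (x + y) (x' + y').
Proof. by rewrite /pcong => xx yy; rewrite opprD addrACA pdvdD. Qed.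

Lemma pcongN m x x' : pcong m x x' -> pcong m (- x) (- x').
Proof. by rewrite /pcong -opprD pdvdN. Qed.

Lemma pcongB m x y x' y' : pcong m x x' -> pcong m y y' -> pcong m (x - y) (x' - y').
Proof. by move=> xx /pcongN; apply: pcongD. Qed.

Lemma pcongZ m k a x x' : pdvd k a -> pcong m x x' -> pcong (k + m) (a * x) (a * x').
Proof. by rewrite /pcong -mulrBr; apply: pdvdM. Qed.

Lemma pcongMl m a x x' : a \is a pint p -> pcong m x x' -> pcong m (a * x) (a * x').
Proof. by rewrite /pcong -mulrBr; apply: pdvdMl. Qed.

Lemma pcongM m x y x' y' : x \is a pint p -> y' \is a pint p ->
  pcong m x x' -> pcong m y y' -> pcong m (x * y) (x' * y').
Proof.
move=> xp yp xx yy; apply: (@pcong_trans m (x * y')); first exact: pcongMl.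
by rewrite ![_ * y']mulrC; apply: pcongMl.
Qed.

Lemma pcongW m k x y : (k <= m)%N -> pcong m x y -> pcong k x y.
Proof. exact: pdvdW. Qed.

Lemma pcong_sum (I : eqType) m (s : seq I) (P : pred I) (F G : I -> rat) :
  (forall i, i \in s -> P i -> pcong m (F i) (G i)) ->
  pcong m (\sum_(i <- s | P i) F i) (\sum_(i <- s | P i) G i).
Proof. by move=> FG; rewrite /pcong -sumrB; apply: pdvd_sum. Qed.

Lemma pcong_pint m x y : pcong m x y -> y \is a pint p -> x \is a pint p.
Proof. by move=> /pdvd_pint xy yp; rewrite -[x](subrK y) rpredD. Qed.

Lemma pcong_pdvd m x y : pcong m x y -> pdvd m y -> pdvd m x.
Proof. by move=> xy yp; rewrite -[x](subrK y) pdvdD. Qed.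

End PowerCongruence.

(** * The exact evaluation *)

(** Equal to binomial(2k, k) / 4^k. *)
Definition cpoch (k : nat) : rat := pochhammer (1 / 2) k / pochhammer 1 k.

Lemma pochhammer0 x : pochhammer x 0 = 1.
Proof. by rewrite /pochhammer big_ord0. Qed.

Lemma pochhammerS x k : pochhammer x k.+1 = pochhammer x k * (x + k%:R).
Proof. by rewrite /pochhammer big_ord_recr. Qed.

Lemma pochhammer1_neq0 k : pochhammer 1 k != 0.
Proof.
elim: k => [|k IH]; first by rewrite pochhammer0 oner_neq0.
by rewrite pochhammerS mulf_neq0 // nat1r pnatr_eq0.
Qed.

Lemma cpoch0 : cpoch 0 = 1.
Proof. by rewrite /cpoch !pochhammer0 divr1. Qed.

Lemma cpochS k : cpoch k.+1 = cpoch k * ((2 * k%:R + 1) / (2 * k%:R + 2)).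
Proof.
rewrite /cpoch !pochhammerS; field.
have k0 := ler0n rat k; have := pochhammer1_neq0 k.
by move=> ?; repeat (apply/andP; split) => //; lra.
Qed.

(* The increments of the right-hand summand in N telescope in m, with h_m below. *)
Lemma half_convolution (N : nat) :
  \sum_(0 <= k < N.+1) (4 * k%:R + 1) * cpoch k ^+ 4 =
  \sum_(0 <= m < N.+1)
    2 * (2 * N%:R + 1) ^+ 2 * cpoch N ^+ 2 * cpoch (N - m) * cpoch (N.+1 + m)
      / (2 * m%:R + 1).
Proof.
elim: N => [|N IH].
  by rewrite !big_nat1 !cpochS cpoch0.
rewrite big_nat_recr //= IH [RHS]big_nat_recr //=.
pose F (N m : nat) : rat :=
  2 * (2 * N%:R + 1) ^+ 2 * cpoch N ^+ 2 * cpoch (N - m) * cpoch (N.+1 + m)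
      / (2 * m%:R + 1).
pose h m := cpoch (N.+1 - m) * cpoch (N.+1 + m).
have tele m : (m <= N.+1)%N ->
  \sum_(0 <= i < m) F N.+1 i = \sum_(0 <= i < m) F N i
     + (4 * N.+1%:R + 1) * cpoch N.+1 ^+ 2 * (h 0 - h m).
  elim: m => [|m IHm] mN; first by rewrite !big_geq // subrr mulr0 addr0.
  rewrite !big_nat_recr //= IHm 1?ltnW // -!addrA; congr (_ + _).
  rewrite /F /h; have [q ->] : exists q, N = (m + q)%N by exists (N - m)%N; lia.
  have -> : ((m + q).+1 - m = q.+1)%N by lia.
  have -> : (m + q - m = q)%N by lia.
  have -> : ((m + q).+1 - m.+1 = q)%N by lia.
  rewrite !addSn !addnS ?subn0 ?addn0 !cpochS.
  rewrite ?(natrD, =^~ natr1).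
  have m0 := ler0n rat m; have q0 := ler0n rat q.
  field; repeat (apply/andP; split); lra.
rewrite -/(F N.+1 N.+1) tele // -!addrA; congr (_ + _).
rewrite /F /h subn0 addn0 subnn cpoch0.
have -> : (N.+2 + N.+1 = (N.+1 + N.+1).+1)%N by lia.
rewrite [cpoch (_ + _).+1]cpochS; have n0 := ler0n rat N.
rewrite natrD -!natr1; field; repeat (apply/andP; split); lra.
Qed.

Definition cprod (n d : nat) : rat :=
  \prod_(1 <= j < d) ((1 + (-1) ^+ j * (n%:R / j%:R)) / (1 - (-1) ^+ j * (n%:R / j%:R))).

(** Passing from m to m + 1 multiplies the left side by (n - d)(n + d + 1) / ((n + d)(n - d - 1)),
    which is the product of the factors of [cprod] at the odd index d and the even index d + 1. *)
Lemma cpoch_symm (N m : nat) : (m <= N)%N ->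
  let n := (2 * N + 1)%N in let d := (2 * m + 1)%N in
  (n + d)%:R * (cpoch (N - m) * cpoch (N.+1 + m)) =
  n%:R * cpoch N ^+ 2 * cprod n d.
Proof.
elim: m => [|m IH] mN /=.
  rewrite /cprod big_geq // subn0 addn0 cpochS !natrD !natrM.
  by have n0 := ler0n rat N; field; lra.
have -> : (2 * m.+1 + 1 = (2 * m + 1).+2)%N by lia.
rewrite /cprod !big_nat_recr /=; try lia.
rewrite -/(cprod _ _).
have -> : (-1) ^+ (2 * m + 1) = -1 :> rat by rewrite -signr_odd oddD oddM.
have -> : (-1) ^+ (2 * m + 1).+1 = 1 :> rat by rewrite -signr_odd /= oddD oddM.
move: (IH (ltnW mN)) => /=.
have [q ->] : exists q, N = (m + q.+1)%N by exists (N - m).-1; lia.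
have -> : (m + q.+1 - m = q.+1)%N by lia.
have -> : (m + q.+1 - m.+1 = q)%N by lia.
have -> : ((m + q.+1).+1 + m.+1 = ((m + q.+1).+1 + m).+1)%N by lia.
rewrite (cpochS q) (cpochS (_ + m)) => IHm.
rewrite -[cprod _ _ * _ * _]mulrA [RHS]mulrA -IHm.
have m0 := ler0n rat m; have q0 := ler0n rat q.
rewrite ?(natrD, =^~ natr1, natrM).
field; repeat (apply/andP; split); lra.
Qed.

Lemma pochhammerD x m k : pochhammer x (m + k) = pochhammer x m * pochhammer (x + m%:R) k.
Proof.
rewrite /pochhammer big_split_ord /=; congr (_ * _).
by apply: eq_bigr => i _; rewrite natrD addrA.
Qed.

(** Counting down from the end writes each factor relative to [x + k], which is n/2 or n in the uses
    below, with n = 2N + 1. *)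
Lemma pochhammer_rev x k :
  pochhammer x k = \prod_(1 <= j < k.+1) (x + k%:R - j%:R).
Proof.
rewrite /pochhammer big_nat_rev /= big_add1 /= big_mkord.
apply: eq_bigr => i _; have ik := ltn_ord i.
have -> : (1 + k.+1 - i.+2 = k - i)%N by lia.
by rewrite natrB 1?ltnW //; ring.

Qed.

Lemma pochhammer1 k : pochhammer 1 k = \prod_(1 <= j < k.+1) j%:R.
Proof.
rewrite /pochhammer big_add1 /= big_mkord.
by apply: eq_bigr => i _; rewrite nat1r.
Qed.

(** Collecting the factors by j <= N gives (u - 1)^3 (u + 1) / (2u - 1) for each j, and (1 - u)^3 (1
    + u) = (1 - 2u) + u^3 (2 - u). The one unpaired factor, (n/2) / n, absorbs the 2 on the left. *)
Lemma cpoch_top (N : nat) (u := fun j => (2 * N + 1)%:R / (2 * j)%:R : rat) :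
  2 * cpoch N ^+ 2 * cpoch (2 * N + 1) =
  \prod_(1 <= j < N.+1) (1 + u j ^+ 3 * (2 - u j) / (1 - 2 * u j)).
Proof.
set n : rat := (2 * N + 1)%:R.
have topE : pochhammer (1 / 2) (2 * N + 1) =
   pochhammer (1 / 2) N * (n / 2) * \prod_(1 <= j < N.+1) (n / 2 + j%:R).
  have -> : (2 * N + 1 = N + N.+1)%N by lia.
  rewrite pochhammerD -mulrA; congr (_ * _).
  rewrite {1}/pochhammer big_ord_recl /= addr0; congr (_ * _).
    by rewrite /n natrD natrM; field.
  rewrite big_add1 /= big_mkord; apply: eq_bigr => i _.
  by rewrite /bump leq0n add1n -[i.+1%:R]nat1r /n natrD natrM; field.
have botE : pochhammer 1 (2 * N + 1) =
   pochhammer 1 N * n * \prod_(1 <= j < N.+1) (n - j%:R).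
  have -> : (2 * N + 1 = N + N.+1)%N by lia.
  rewrite pochhammerD -mulrA; congr (_ * _).
  rewrite pochhammerS pochhammer_rev mulrC /n natrD natrM; congr (_ * _); first ring.
  by apply: eq_bigr => i _; ring.
have lowE : pochhammer (1 / 2) N = \prod_(1 <= j < N.+1) (n / 2 - j%:R).
  rewrite pochhammer_rev; apply: eq_bigr => j _.
  by rewrite /n natrD natrM; field.
have n0 : 0 < n by rewrite ltr0n; lia.
rewrite /cpoch topE botE pochhammer1 lowE.
have prodV (F G : nat -> rat) : \prod_(1 <= j < N.+1) F j / \prod_(1 <= j < N.+1) G j
   = \prod_(1 <= j < N.+1) (F j / G j) by rewrite prodf_div.
transitivity (\prod_(1 <= j < N.+1) (((n / 2 - j%:R) / j%:R) ^+ 3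
                * ((n / 2 + j%:R) / (n - j%:R)))).
  rewrite big_split /= prodrXl -!prodV; field.
  have top0 : \prod_(1 <= j < N.+1) (n - j%:R) != 0.
    apply/negP => /eqP P0; have := pochhammer1_neq0 (2 * N + 1).
    by rewrite botE P0 mulr0 eqxx.
  by rewrite top0 -pochhammer1 pochhammer1_neq0 /= lt0r_neq0 // -natrM natr1 ltr0Sn.
apply: eq_big_nat => j /andP[j0 jN]; rewrite /u natrM.
have j1 : 0 < j%:R :> rat by rewrite ltr0n.
have jn : j%:R * 2 < n by rewrite /n -natrM ltr_nat; lia.
field; repeat (apply/andP; split); lra.
Qed.

Lemma sum_odd (N : nat) (F : nat -> rat) :
  \sum_(0 <= m < N) F (2 * m + 1)%N = \sum_(1 <= d < 2 * N + 1 | odd d) F d.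
Proof.
elim: N => [|N IH]; first by rewrite !big_geq.
have -> : (2 * N.+1 + 1 = (2 * N + 1).+2)%N by lia.
rewrite big_nat_recr // IH big_mkcond [RHS]big_mkcond /= !big_nat_recr /=; try lia.
by rewrite oddD oddM /= addr0.
Qed.

Lemma sum_even (N : nat) (F : nat -> rat) :
  \sum_(1 <= j < N.+1) F (2 * j)%N = \sum_(1 <= e < 2 * N + 1 | ~~ odd e) F e.
Proof.
elim: N => [|N IH]; first by rewrite !big_geq.
have -> : (2 * N.+1 + 1 = (2 * N + 1).+2)%N by lia.
rewrite big_nat_recr // IH big_mkcond [RHS]big_mkcond /= !big_nat_recr /=; try lia.
rewrite oddD oddM /= addr0; congr (_ + F _); lia.
Qed.

(** The summand m = N of [half_convolution], where d = n, is the product of [cpoch_top]. In the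
    others [cpoch_symm] produces n^2 / (d (n + d)), which is (n/d)^2 / (1 + n/d); these involve only
    ratios n/j with j < n. *)
Lemma quartic_sum_split (N : nat) (u := fun j => (2 * N + 1)%:R / (2 * j)%:R : rat) :
  \sum_(0 <= k < N.+1) (4 * k%:R + 1) * cpoch k ^+ 4 =
  (2 * N + 1)%:R *
  (\prod_(1 <= j < N.+1) (1 + u j ^+ 3 * (2 - u j) / (1 - 2 * u j))
   + 2 * cpoch N ^+ 4 * \sum_(1 <= d < 2 * N + 1 | odd d)
      ((2 * N + 1)%:R / d%:R) ^+ 2 / (1 + (2 * N + 1)%:R / d%:R)
        * cprod (2 * N + 1) d).
Proof.
rewrite half_convolution big_nat_recr //= addrC mulrDr; congr (_ + _).
  rewrite -cpoch_top subnn cpoch0; have -> : (N.+1 + N = 2 * N + 1)%N by lia.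
  by rewrite natrD natrM; field; have := ler0n rat N; lra.
rewrite -sum_odd !mulr_sumr; apply: eq_big_nat => m /andP[_ mN].
have /= E := cpoch_symm (ltnW mN).
have N0 := ler0n rat N; have m0 := ler0n rat m.
transitivity (2 * cpoch N ^+ 2 * (2 * N + 1)%:R ^+ 2
  / ((2 * m + 1)%:R * (2 * N + 1 + (2 * m + 1))%:R) *
  ((2 * N + 1)%:R * cpoch N ^+ 2 * cprod (2 * N + 1) (2 * m + 1))).
  by rewrite -E !(natrD, natrM); field; apply/andP; split; lra.
by rewrite !(natrD, natrM); field; repeat (apply/andP; split); lra.
Qed.

Lemma cpoch_prod (N : nat) :
  cpoch N = \prod_(1 <= j < N.+1) ((2 * N + 1)%:R / (2 * j)%:R - 1).
Proof.
rewrite /cpoch pochhammer1 pochhammer_rev.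
rewrite -prodf_div; apply: eq_big_nat => j /andP[j0 _].
rewrite natrD !natrM; have : 0 < j%:R :> rat by rewrite ltr0n.
by move=> ?; field; lra.
Qed.

(** * Reduction to harmonic sums below p *)

(** Every discarded term of the expanded product contains at least two of the [a i]. *)
Lemma pcong_prod1D p (p_gt1 : (1 < p)%N) (I : eqType) m (s : seq I) (a : I -> rat) :
  (forall i, i \in s -> pdvd p m (a i)) ->
  pcong p (m + m) (\prod_(i <- s) (1 + a i)) (1 + \sum_(i <- s) a i).
Proof.
elim: s => [|i s IH] ap; first by rewrite !big_nil addr0; apply: pcong_refl.
have ai : pdvd p m (a i) by apply: ap; rewrite mem_head.
have as_ j : j \in s -> pdvd p m (a j) by move=> js; apply: ap; rewrite inE js orbT.
rewrite !big_cons.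
apply: (@pcong_trans _ _ ((1 + a i) * (1 + \sum_(j <- s) a j))).
  by apply: pcongMl; rewrite ?rpredD ?rpred1 ?(pdvd_pint p_gt1 ai) //; apply: IH.
rewrite /pcong (_ : _ - _ = a i * \sum_(j <- s) a j); last by ring.
by apply: pdvdM => //; apply: pdvd_sum => j js _; apply: as_.
Qed.

Lemma sum_multiples (q M : nat) (F : nat -> rat) : (0 < q)%N ->
  \sum_(1 <= d < q * M | (q %| d)%N) F d = \sum_(1 <= d < M) F (q * d)%N.
Proof.
move=> q0; case: M => [|M]; first by rewrite muln0 !big_geq.
(* With index 0 added on both sides, the induction can proceed by whole blocks of length q. *)
apply: (@addrI _ (F 0)).
suff main M' : \sum_(0 <= d < q * M' | (q %| d)%N) F d = \sum_(0 <= d < M') F (q * d)%N.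
  move: (main M.+1); rewrite [in RHS]big_ltn // muln0 => <-.
  by rewrite [RHS]big_mkcond [RHS]big_ltn ?muln_gt0 ?q0 // dvdn0 -big_mkcond.
elim: M' => [|M' IH]; first by rewrite muln0 !big_geq.
rewrite big_nat_recr //= -IH [LHS](@big_cat_nat _ _ _ (q * M')) ?leq_mul //=; congr (_ + _).
(* Only the first index of the last block is a multiple of q. *)
rewrite big_mkcond big_ltn ?ltn_mul2l ?q0 ?ltnSn // dvdn_mulr // big_nat_cond.
rewrite big1; first exact: addr0.
move=> d /andP[/andP[d1 d2] _]; case: ifP => // /dvdnP[k dk].
by move: d1 d2; rewrite dk (mulnC k) !ltn_mul2l q0 /=; lia.
Qed.

Section PrimePower.
Variable p : nat.
Hypotheses (p_prime : prime p) (p_gt3 : (3 < p)%N).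

Let p_gt1 : (1 < p)%N. Proof. exact: prime_gt1. Qed.

(** The valuation of j is at most t, so at least k factors p survive in the quotient. *)
Lemma pdvd_div t k j : (0 < j)%N -> ~~ (p ^ t.+1 %| j)%N ->
  pdvd p k ((p ^ (t + k))%:R / j%:R).
Proof.
move=> j0; rewrite pfactor_dvdn // -leqNgt => lt.
have [m pm jE] := pfactor_coprime p_prime j0.
have m0 : (0 < m)%N by move: j0; rewrite jE muln_gt0 => /andP[].
move: lt; rewrite {2}jE; move: (logn p j) => l lt.
have p0 : p%:R != 0 :> rat by rewrite pnatr_eq0; lia.
have -> : (p ^ (t + k))%:R / (m * p ^ l)%:R = p%:R ^+ k * ((p ^ (t - l))%:R / m%:R) :> rat.
  rewrite natrM !natrX addnC exprD -[in LHS](subnK lt) exprD.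
  by field; rewrite pnatr_eq0 -lt0n m0 expf_neq0.
by apply: pdvd_exp => //; rewrite rpredM ?rpred_nat // pintV_nat.
Qed.

Lemma pcong_descent m s M (F : nat -> rat) :
  (forall d, (0 < d < p ^ s * M)%N -> ~~ (p ^ s %| d)%N -> pdvd p m (F d)) ->
  pcong p m (\sum_(1 <= d < p ^ s * M) F d) (\sum_(1 <= d < M) F (p ^ s * d)%N).
Proof.
move=> Fm; rewrite -sum_multiples ?expn_gt0 ?prime_gt0 //.
rewrite [X in pcong _ _ _ X]big_mkcond /=; apply: pcong_sum => d.
rewrite mem_index_iota => dM _; case: ifPn => qd; first exact: pcong_refl.
by rewrite /pcong subr0 Fm.
Qed.

End PrimePower.

Section Reduction.
Variable p : nat.
Hypotheses (p_prime : prime p) (p_gt3 : (3 < p)%N).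

Let p_gt1 : (1 < p)%N. Proof. exact: prime_gt1. Qed.

Lemma prime_gt3_odd : odd p. Proof. by case/even_prime: p_prime => // p2; lia. Qed.

Lemma pintV b : (0 < b < p)%N -> b%:R^-1 \is a pint p.
Proof.
case/andP=> b0 bp; apply: pintV_nat => //.
by rewrite prime_coprime // gtnNdvd.
Qed.

(** The factor U^2 already has order 2, so R / (1 + U) is needed only modulo p^2, where it is 1 - U
    + T. *)
Lemma tail_term_pcong U T R : pdvd p 1 U -> pdvd p 1 T -> pcong p 2 R (1 + T) ->
  pcong p 4 (U ^+ 2 / (1 + U) * R) (U ^+ 2 - U ^+ 3 + U ^+ 2 * T).
Proof.
move=> U1 T1 RT.
have [U0 Ui] := pdvd1_unit p_gt1 U1.
have Up := pdvd_pint p_gt1 U1; have Tp := pdvd_pint p_gt1 T1.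
have U2 : pdvd p 2 (U ^+ 2) by apply: (@pdvdX _ 1 2).
have -> : U ^+ 2 / (1 + U) * R = U ^+ 2 * ((1 + U)^-1 * R) by rewrite mulrA.
have -> : U ^+ 2 - U ^+ 3 + U ^+ 2 * T = U ^+ 2 * (1 - U + T) by ring.
apply: (@pcongZ _ 2 2) => //.
apply: (@pcong_trans _ _ ((1 + U)^-1 * (1 + T))); first exact: pcongMl.
rewrite /pcong (_ : _ - _ = (U ^+ 2 - U * T) * (1 + U)^-1); last by field.
apply: pdvdMr => //; apply: pdvdD => //; rewrite pdvdN.
exact: (@pdvdM _ 1 1).
Qed.

Lemma pdvd_sign j x : pdvd p 1 x -> pdvd p 1 ((-1) ^+ j * x).
Proof. by apply: pdvdMl; rewrite rpredX // rpredN rpred1. Qed.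

(** Each factor (1 + x) / (1 - x) is 1 + 2x / (1 - x), which is 1 + 2x up to a multiple of x^2;
    cross terms also have order 2. *)
Lemma cprod_pcong n d : (forall j, (0 < j < d)%N -> pdvd p 1 (n%:R / j%:R)) ->
  pcong p 2 (cprod n d) (1 + \sum_(1 <= j < d) 2 * ((-1) ^+ j * (n%:R / j%:R))).
Proof.
move=> un.
have -> : cprod n d = \prod_(1 <= j < d) (1 + 2 * ((-1) ^+ j * (n%:R / j%:R))
                   / (1 - (-1) ^+ j * (n%:R / j%:R))).
  apply: eq_big_nat => j /un/(pdvd_sign j); rewrite -pdvdN => /(pdvd1_unit p_gt1)[x0 _].
  by move: x0; move: (_ * _) => x x0; field.
have main j : j \in index_iota 1 d ->
  let x := (-1) ^+ j * (n%:R / j%:R) in [/\ pdvd p 1 (2 * x / (1 - x))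
    & pcong p 2 (2 * x / (1 - x)) (2 * x)].
  rewrite mem_index_iota => /un/(pdvd_sign j); move: (_ * _) => x x1 /=.
  have [] := @pdvd1_unit _ p_gt1 (- x); rewrite ?pdvdN // => x0 xi.
  split; first by rewrite pdvdMr ?pdvdMl ?rpred_nat.
  rewrite /pcong (_ : _ - _ = 2 * (x * x) * (1 - x)^-1); last by field.
  by rewrite pdvdMr // pdvdMl ?rpred_nat //; apply: (@pdvdM _ 1 1).
apply: pcong_trans (@pcong_prod1D _ _ _ 1 _ _ _) _ => //.
  by move=> j /main[].
apply: pcongD; first exact: pcong_refl.
by apply: pcong_sum => j /main[].
Qed.

(** The exponent of the theorem is [r.+1] here, so that the indices surviving the descent are the
    multiples of p^r. *)
Variables (r N : nat).
Hypothesis nE : (p ^ r.+1 = 2 * N + 1)%N.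
Let n := (p ^ r.+1)%N.

Lemma pdvd_ratio j : (0 < j < n)%N -> pdvd p 1 (n%:R / j%:R).
Proof.
case/andP=> j0 jn; rewrite /n -(addn1 r); apply: pdvd_div => //.
by rewrite gtnNdvd.
Qed.

Let u (j : nat) : rat := n%:R / (2 * j)%:R.

Let pdvd_u j : (0 < j < N.+1)%N -> pdvd p 1 (u j).
Proof. by move=> jN; apply: pdvd_ratio; rewrite /n nE; lia. Qed.

(** The corrections have order 3, so their cross products have order 6; replacing each of them by
    2u^3 costs 3u^4 / (1 - 2u). *)
Lemma top_pcong :
  pcong p 4 (\prod_(1 <= j < N.+1) (1 + u j ^+ 3 * (2 - u j) / (1 - 2 * u j)))
    (1 + \sum_(1 <= j < N.+1) 2 * u j ^+ 3).
Proof.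
have main j : j \in index_iota 1 N.+1 ->
  [/\ pdvd p 3 (u j ^+ 3 * (2 - u j) / (1 - 2 * u j))
    & pcong p 4 (u j ^+ 3 * (2 - u j) / (1 - 2 * u j)) (2 * u j ^+ 3)].
  rewrite mem_index_iota => /pdvd_u; move: (u j) => x x1.
  have xp := pdvd_pint p_gt1 x1.
  have [] := @pdvd1_unit _ p_gt1 (- (2 * x)).
    by rewrite pdvdN pdvdMl ?rpred_nat.
  move=> x0 xi; split.
    by rewrite -mulrA pdvdMr ?rpredM ?rpredB ?rpred_nat //; apply: (@pdvdX _ 1 3).
  rewrite /pcong (_ : _ - _ = 3 * x ^+ 4 * (1 - 2 * x)^-1); last by field.
  by rewrite pdvdMr // pdvdMl ?rpred_nat //; apply: (@pdvdX _ 1 4).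
apply: (@pcong_trans _ _ (1 + \sum_(1 <= j < N.+1) u j ^+ 3 * (2 - u j) / (1 - 2 * u j))).
  by apply: (@pcongW _ p_gt1 6) => //; apply: (@pcong_prod1D _ _ _ 3) => // j /main[].
apply: pcongD; first exact: pcong_refl.
by apply: pcong_sum => j /main[].
Qed.

(** Each factor u - 1 of c_N is -1 modulo p, and the fourth power removes the sign. *)
Lemma cpoch_pcong : pcong p 1 (cpoch N ^+ 4) 1.
Proof.
rewrite cpoch_prod -nE -/n -prodrXl.
have -> : \prod_(1 <= j < N.+1) (u j - 1) ^+ 4 =
          \prod_(1 <= j < N.+1) (1 + u j * (u j ^+ 3 - 4 * u j ^+ 2 + 6 * u j - 4)).
  by apply: eq_bigr => j _; ring.
have main j : j \in index_iota 1 N.+1 ->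
   pdvd p 1 (u j * (u j ^+ 3 - 4 * u j ^+ 2 + 6 * u j - 4)).
  rewrite mem_index_iota => /pdvd_u u1; have up := pdvd_pint p_gt1 u1.
  rewrite pdvdMr //; repeat first
    [exact: up | exact: rpred_nat | apply: rpredB | apply: rpredD | apply: rpredM | apply: rpredX].
apply: (@pcong_trans _ _ (1 + \sum_(1 <= j < N.+1) u j * (u j ^+ 3 - 4 * u j ^+ 2 + 6 * u j - 4))).
  by apply: (@pcongW _ p_gt1 2) => //; apply: (@pcong_prod1D _ _ _ 1).
rewrite /pcong addrAC subrr add0r; apply: pdvd_sum => j /main //.
Qed.

(** Stated for a general k because it is used both at n and, after the descent, at p. *)
Definition tail_sum k := \sum_(1 <= d < k | odd d)
  ((k%:R / d%:R) ^+ 2 - (k%:R / d%:R) ^+ 3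
   + (k%:R / d%:R) ^+ 2 * \sum_(1 <= j < d) 2 * ((-1) ^+ j * (k%:R / j%:R)) : rat).

Lemma tail_pcong : pcong p 4
  (\sum_(1 <= d < n | odd d) (n%:R / d%:R) ^+ 2 / (1 + n%:R / d%:R) * cprod n d)
  (tail_sum n).
Proof.
apply: pcong_sum => d; rewrite mem_index_iota => /andP[d0 dn] _.
have jn j : (0 < j < d)%N -> pdvd p 1 (n%:R / j%:R).
  by move=> jd; apply: pdvd_ratio; lia.
apply: tail_term_pcong; first by apply: pdvd_ratio; rewrite d0.
  by apply: pdvd_sum => j; rewrite mem_index_iota => /jn j1 _; rewrite pdvdMl ?rpred_nat ?pdvd_sign.
exact: cprod_pcong.
Qed.

Lemma ratio_descent d : n%:R / (p ^ r * d)%:R = p%:R / d%:R :> rat.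
Proof.
rewrite /n expnS mulnC !natrM -mulf_div divff ?mul1r // pnatr_eq0 expn_eq0; lia.
Qed.

(** Such a d has valuation at most r - 1, which leaves two factors p in n/d; for r = 0 no such d
    exists. *)
Lemma pdvd_ratio2 d : (0 < d)%N -> ~~ (p ^ r %| d)%N -> pdvd p 2 (n%:R / d%:R).
Proof.
rewrite /n; case: r => [|t] d0 td; first by rewrite expn0 dvd1n in td.
by rewrite -(addn2 t); apply: pdvd_div.
Qed.

Lemma nMp : n = (p ^ r * p)%N. Proof. by rewrite /n expnSr. Qed.

Lemma ratio_pcong m (F : nat -> rat) :
  (forall d, (0 < d < n)%N -> ~~ (p ^ r %| d)%N -> pdvd p m (F d)) ->
  pcong p m (\sum_(1 <= d < n) F d) (\sum_(1 <= d < p) F (p ^ r * d)%N).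
Proof. by rewrite nMp; apply: pcong_descent. Qed.

(** Away from the multiples of p^r the cubes have order 6, and multiplication by the odd number p^r
    preserves parity. *)
Lemma even_descent :
  pcong p 4 (\sum_(1 <= e < n | ~~ odd e) (n%:R / e%:R) ^+ 3)
            (\sum_(1 <= e < p | ~~ odd e) (p%:R / e%:R) ^+ 3).
Proof.
rewrite big_mkcond [X in pcong _ _ _ X]big_mkcond /=.
apply: pcong_trans (ratio_pcong _) _ => [d /andP[d0 _] /(pdvd_ratio2 d0) d2|].
  case: ifP => _; last exact: pdvd_0.
  by apply: (@pdvdW _ p_gt1 6) => //; apply: (@pdvdX _ 2 3).
apply: eq_pcong; apply: eq_bigr => d _.
by rewrite oddM oddX prime_gt3_odd orbT /= ratio_descent.
Qed.

(** The descent is made twice. For d not a multiple of p^r, (n/d)^2 has order 4 and the inner sum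
    only has to be p-integral. For the remaining d, the prefactor (p/d)^2 has order 2, so the inner
    sum may be reduced modulo p^2; its signs survive because p^r is odd. *)
Lemma tail_sum_descent : pcong p 4 (tail_sum n) (tail_sum p).
Proof.
rewrite /tail_sum big_mkcond [X in pcong _ _ _ X]big_mkcond /=.
apply: pcong_trans (ratio_pcong _) _ => [d dn /pdvd_ratio2|].
  case: ifP => _; last by rewrite pdvd_0.
  case/andP: (dn) => d0 _ /(_ d0) d2; have dp := pdvd_pint p_gt1 d2.
  apply: pdvdD; last first.
    apply: pdvdMr; first exact: (@pdvdX _ 2 2).
    rewrite -pdvd0; apply: pdvd_sum => j; rewrite mem_index_iota => /andP[j0 jd] _.
    rewrite (@pdvdW _ p_gt1 1) // pdvdMl ?rpred_nat // pdvd_sign // pdvd_ratio //; lia.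
  apply: pdvdD; first exact: (@pdvdX _ 2 2).
  by rewrite pdvdN; apply: (@pdvdW _ p_gt1 6) => //; apply: (@pdvdX _ 2 3).
apply: pcong_sum => d; rewrite mem_index_iota => /andP[d0 dp] _.
rewrite oddM oddX prime_gt3_odd orbT /= ratio_descent; case: ifP => _; last exact: pcong_refl.
apply: pcongD; first exact: pcong_refl.
apply: (@pcongZ _ 2 2).
  rewrite expr_div_n; apply: pdvd_exp; rewrite // -exprVn rpredX // pintV //; exact/andP.
apply: pcong_trans (@pcong_descent _ p_prime 2 r d _ _) _ => //.
  move=> j /andP[j0 _] /(pdvd_ratio2 j0) j2.
  by rewrite pdvdMl ?rpred_nat // pdvdMl ?rpredX ?rpredN ?rpred1.
apply: eq_pcong; apply: eq_bigr => j _.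
by rewrite ratio_descent -[in LHS]signr_odd oddM oddX prime_gt3_odd orbT /= signr_odd.
Qed.

(** The factor c_N^4 is known to be 1 only modulo p; order 3 of the tail sum raises this to a
    congruence modulo p^4. *)
Lemma quartic_sum_reduction : pdvd p 3 (tail_sum p) ->
  exists2 X, \sum_(0 <= k < N.+1) (4 * k%:R + 1) * cpoch k ^+ 4 = n%:R * X
  & pcong p 4 X (1 + 2 * \sum_(1 <= e < p | ~~ odd e) (p%:R / e%:R) ^+ 3 + 2 * tail_sum p).
Proof.
move=> psum3; have := quartic_sum_split N; rewrite -nE -/n => /= ->; eexists; first by [].
apply: pcongD.
  apply: pcong_trans top_pcong _; apply: pcongD; first exact: pcong_refl.
  rewrite -mulr_sumr (sum_even N (fun e => (n%:R / e%:R) ^+ 3)) -nE.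
  by apply: pcongMl; rewrite ?rpred_nat //; apply: even_descent.
have tail4 := pcong_trans tail_pcong tail_sum_descent.
rewrite -[X in pcong _ _ X _]mulrA; apply: pcongMl; first exact: rpred_nat.
apply: (@pcong_trans _ _ (cpoch N ^+ 4 * tail_sum p)).
  by apply: pcongMl => //; apply: (pcong_pint p_gt1 cpoch_pcong); rewrite rpred1.
rewrite -[X in pcong _ _ _ X]mulr1 mulrC.
by apply: (@pcongZ _ 1 3) => //; exact: cpoch_pcong.
Qed.

End Reduction.

(** * Bernoulli numbers and harmonic sums *)

Lemma size_bern_seq m : size (bern_seq m) = m.+1.
Proof. by elim: m => //= m IH; rewrite size_rcons IH. Qed.

(** Each list extends the previous one, so all sufficiently long lists agree at k. *)
Lemma nth_bern_seq m k : (k <= m)%N -> nth 0 (bern_seq m) k = bernoulli k.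
Proof.
elim: m => [|m IH] km; first by move: km; rewrite leqn0 => /eqP ->.
move: km; rewrite leq_eqVlt => /predU1P[-> //|km].
by rewrite /= nth_rcons size_bern_seq km IH.
Qed.

Lemma bernoulliS m : bernoulli m.+1 =
  - (m.+2%:R)^-1 * \sum_(0 <= k < m.+1) 'C(m.+2, k)%:R * bernoulli k.
Proof.
rewrite {1}/bernoulli /= nth_rcons.
rewrite size_bern_seq ltnn eqxx big_mkord; congr (_ * _); apply: eq_bigr => k _.
by rewrite nth_bern_seq // -ltnS ltn_ord.
Qed.

(** Expand (j + 1)^(m+1) - j^(m+1) by the binomial theorem and telescope in j. The convention 0^0 =
    1 makes the sum for l = 0 equal to p. *)
Lemma sum_powers_tele p m :
  \sum_(0 <= l < m.+1) 'C(m.+1, l)%:R * (\sum_(0 <= j < p) j%:R ^+ l) = p%:R ^+ m.+1 :> rat.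
Proof.
under eq_bigr do rewrite mulr_sumr.
rewrite exchange_big /=.
transitivity (\sum_(0 <= j < p) (j.+1%:R ^+ m.+1 - j%:R ^+ m.+1) : rat).
  apply: eq_bigr => j _; rewrite -nat1r exprDn.
  rewrite big_ord_recr /= subnn expr0 binn mul1r mulr1n addrK big_mkord.
  by apply: eq_bigr => l _; rewrite expr1n mul1r mulr_natl.
by rewrite telescope_sumr // expr0n subr0.
Qed.

Section Prime.
Variable p : nat.
Hypotheses (p_prime : prime p) (p_gt3 : (3 < p)%N).

Let p_gt1 : (1 < p)%N. Proof. exact: prime_gt1. Qed.

Let p_gt4 : (4 < p)%N.
Proof. by have := prime_gt3_odd p_prime p_gt3; rewrite ltn_neqAle p_gt3 andbT; case: eqP => // <-. Qed.

(** By [sum_powers_tele] the power sums obey the Bernoulli recursion up to a power of p that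
    vanishes modulo p^2. The bound on m keeps the divisors of the recursion prime to p. *)
Lemma sum_powers_bernoulli m : (m < p - 2)%N ->
  pcong p 2 (\sum_(0 <= j < p) j%:R ^+ m) (p%:R * bernoulli m).
Proof.
elim/ltn_ind: m => -[|m] IH mp.
  apply: eq_pcong; rewrite sumr_const_nat subn0; exact/esym/mulr1.
have -> : \sum_(0 <= j < p) j%:R ^+ m.+1 = m.+2%:R^-1 * (p%:R ^+ m.+2
   - \sum_(0 <= l < m.+1) 'C(m.+2, l)%:R * (\sum_(0 <= j < p) j%:R ^+ l)) :> rat.
  rewrite -sum_powers_tele big_nat_recr //= addrAC subrr add0r binSn mulKf //.
  by rewrite pnatr_eq0.
rewrite bernoulliS mulrCA mulNr -mulrN.
apply: pcongMl; first by apply: pintV => //; lia.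
rewrite -[X in pcong _ _ _ X]add0r; apply: pcongB.
  rewrite /pcong subr0 (_ : m.+2 = 2 + m)%N // exprD pdvd_exp //.
  by rewrite rpredX ?rpred_nat.
rewrite mulr_sumr; apply: pcong_sum => l; rewrite mem_index_iota => /andP[_ lm] _.
rewrite mulrCA; apply: pcongMl; first exact: rpred_nat.
by apply: IH => //; lia.
Qed.

Lemma fermat_pcong j : (0 < j < p)%N -> pcong p 1 (j%:R ^+ (p - 1)) 1.
Proof.
case/andP=> j0 jp.
have : (p %| j * (j ^ (p - 1) - 1))%N.
  rewrite mulnBr muln1 -expnS (_ : (p - 1).+1 = p); last by lia.
  rewrite -eqn_mod_dvd; first by apply/eqP; apply: fermat_little.
  by rewrite -{1}(expn1 j) leq_pexp2l // prime_gt0.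
rewrite Gauss_dvdr; last by rewrite prime_coprime // gtnNdvd.
case/dvdnP=> k kE; rewrite /pcong.
have -> : j%:R ^+ (p - 1) - 1 = p%:R ^+ 1 * k%:R :> rat.
  by rewrite -natrX -[X in _ - X]/(1%:R) -natrB ?expn_gt0 ?j0 // kE natrM mulrC.
by rewrite pdvd_exp ?rpred_nat.
Qed.

Lemma pdvd_cancel m b x : (0 < b < p)%N -> pdvd p m (b%:R * x) -> pdvd p m x.
Proof.
move=> bp bx; have b0 : b%:R != 0 :> rat by rewrite pnatr_eq0; lia.
by rewrite -[x](mulKf b0); apply: pdvdMl => //; apply: pintV.
Qed.

Lemma pdvd_cancelp m x : pdvd p m.+1 (p%:R * x) -> pdvd p m x.
Proof.
have p0 : p%:R != 0 :> rat by rewrite pnatr_eq0; lia.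
by rewrite /pdvd exprS invfM mulrACA divff // mul1r.
Qed.

Lemma sum_rev (F : nat -> rat) (m : nat) :
  \sum_(1 <= j < m) F j = \sum_(1 <= j < m) F (m - j)%N.
Proof.
by rewrite big_nat_rev; apply: eq_big_nat => j /andP[j0 jm]; congr F; lia.
Qed.

Lemma sum_odd_rev (F : nat -> rat) :
  \sum_(1 <= d < p | odd d) F d = \sum_(1 <= e < p | ~~ odd e) F (p - e)%N.
Proof.
rewrite big_mkcond [RHS]big_mkcond /= sum_rev; apply: eq_big_nat => e /andP[e0 ep].
by rewrite oddB ?(ltnW ep) // prime_gt3_odd.
Qed.

Definition harm_even k : rat := \sum_(1 <= e < p | ~~ odd e) e%:R ^- k.
Definition harm_odd k : rat := \sum_(1 <= d < p | odd d) d%:R ^- k.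
Notation E3 := (harm_even 3).

(* Splitting the sum into halves and reflecting, or by parity and reflecting the odd
   part, gives two relations from which the half sum can be eliminated. *)
Lemma halving (f : nat -> rat) (a l : rat) :
  a \is a pint p -> l \is a pint p ->
  (forall j, (0 < j < p)%N -> f j \is a pint p) ->
  (forall j, (0 < j < p)%N -> pcong p 2 (f (p - j)%N) (f j + a * p%:R * j%:R ^- 3)) ->
  (forall j, f (2 * j)%N = l * f j) -> pcong p 1 (4 * l) 1 ->
  pcong p 2 (3 * \sum_(1 <= j < p) f j) (- (4 * a * p%:R * E3)).
Proof.
move=> ap lp fp refl dbl l4.
have [M pE] : exists M, p = (2 * M + 1)%N.
  by exists p./2; rewrite -{1}[p]odd_double_half prime_gt3_odd //; lia.
pose FM := \sum_(1 <= j < M.+1) f j; pose F := \sum_(1 <= j < p) f j.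
have FMp : FM \is a pint p.
  rewrite -pdvd0; apply: pdvd_sum => j; rewrite mem_index_iota pdvd0 => jM _.
  by apply: fp; lia.
have E3p : E3 \is a pint p.
  rewrite -pdvd0; apply: pdvd_sum => j; rewrite mem_index_iota pdvd0 => jM _.
  by rewrite -exprVn rpredX // pintV.
have E3E : \sum_(1 <= j < M.+1) j%:R ^- 3 = 8 * E3.
  rewrite /harm_even pE -(sum_even M (fun e => e%:R ^- 3)) mulr_sumr.
  apply: eq_big_nat => j /andP[j0 _]; rewrite natrM.
  by field; rewrite pnatr_eq0 -lt0n.
have F1 : pcong p 2 F (2 * FM + a * p%:R * (8 * E3)).
  rewrite /F [X in \sum_(1 <= _ < X) _](_ : p = (M.+1 + M)%N); last by lia.
  rewrite (@big_cat_nat _ _ _ M.+1) //=; last by lia.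
  rewrite mulr_natl mulr2n -addrA; apply: pcongD; first exact: pcong_refl.
  rewrite -E3E mulr_sumr -big_split /=.
  have -> : \sum_(M.+1 <= j < M.+1 + M) f j = \sum_(1 <= j < M.+1) f (p - j)%N.
    rewrite -{1}[M.+1]add0n big_addn addKn big_add1 /= big_nat_rev.
    by apply: eq_big_nat => j /andP[_ jM]; congr f; lia.
  apply: pcong_sum => j; rewrite mem_index_iota => jM _; apply: refl; lia.
have F2 : pcong p 2 F (2 * (l * FM) + a * p%:R * E3).
  rewrite /F (bigID odd) /= sum_odd_rev -big_split /=.
  have -> : 2 * (l * FM) + a * p%:R * E3 = \sum_(1 <= e < p | ~~ odd e)
        (f e + a * p%:R * e%:R ^- 3 + f e).
    have -> : l * FM = \sum_(1 <= e < p | ~~ odd e) f e.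
      by rewrite pE -sum_even mulr_sumr; apply: eq_bigr => j _; rewrite dbl.
    by rewrite !big_split /= -mulr_sumr -/(harm_even 3); ring.
  apply: pcong_sum => e; rewrite mem_index_iota => ep _.
  by apply: pcongD; [apply: refl | apply: pcong_refl].
(* As 4l is 1 only modulo p, its deviation becomes negligible modulo p^2 once the half sum is known
   to be divisible by p. Comparing the two relations modulo p gives three times the half sum as
   0. *)
have FM1 : pdvd p 1 FM.
  apply: (@pdvd_cancel _ 3) => //.
  have -> : 3 * FM = 2 * ((F - (2 * (l * FM) + a * p%:R * E3))
     - (F - (2 * FM + a * p%:R * (8 * E3)))) + (4 * l - 1) * FM
     - p%:R ^+ 1 * (14 * a * E3) by ring.
  apply: pdvdD; last by rewrite pdvdN pdvd_exp // !rpredM // rpred_nat.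
  apply: pdvdD; last exact: pdvdMr.
  rewrite pdvdMl ?rpred_nat // (@pdvdW _ _ 2) //.
  by apply: pdvdD => //; rewrite pdvdN.
rewrite /pcong.
(* Four times the parity relation minus the reflection relation leaves the half sum with coefficient
   2 (4l - 1). *)
have -> : 3 * \sum_(1 <= j < p) f j - - (4 * a * p%:R * E3) =
  4 * (F - (2 * (l * FM) + a * p%:R * E3)) - (F - (2 * FM + a * p%:R * (8 * E3)))
  + 2 * ((4 * l - 1) * FM) by rewrite /F; ring.
apply: pdvdD; last by rewrite pdvdMl ?rpred_nat //; apply: (@pdvdM _ 1 1).
by apply: pdvdD; rewrite ?pdvdN // pdvdMl ?rpred_nat.
Qed.

Lemma pint_refl_inv (j : nat) : (0 < j < p)%N ->
  [/\ j%:R^-1 \is a pint p, (p - j)%:R^-1 \is a pint p, j%:R != 0 :> rat,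
     p%:R - j%:R != 0 :> rat & (p - j)%:R = p%:R - j%:R :> rat].
Proof.
move=> jp; have pj : (p - j)%:R = p%:R - j%:R :> rat by rewrite natrB //; lia.
split=> //; [apply: pintV | apply: pintV | | rewrite -pj]; rewrite ?pnatr_eq0; lia.
Qed.

(** First-order expansion of (p - j)^-2 in p, with an explicit remainder. *)
Lemma inv_sq_refl j : (0 < j < p)%N ->
  pcong p 2 ((p - j)%:R ^- 2) (j%:R ^- 2 + 2 * p%:R * j%:R ^- 3).
Proof.
move=> /pint_refl_inv[ji pji j0 pj0 pjE]; rewrite /pcong.
have -> : (p - j)%:R ^- 2 - (j%:R ^- 2 + 2 * p%:R * j%:R ^- 3) =
   p%:R ^+ 2 * ((3 * j%:R - 2 * p%:R) * j%:R^-1 ^+ 3 * (p - j)%:R^-1 ^+ 2) :> rat.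
  by rewrite pjE; field; apply/andP.
by rewrite pdvd_exp //; repeat first [exact: ji | exact: pji | exact: rpred_nat
  | apply: rpredB | apply: rpredM | apply: rpredX].
Qed.

Lemma inv_refl j : (0 < j < p)%N -> pcong p 1 (p - j)%:R^-1 (- j%:R^-1).
Proof.
move=> /pint_refl_inv[ji pji j0 pj0 pjE]; rewrite /pcong.
have -> : (p - j)%:R^-1 - - j%:R^-1 = p%:R ^+ 1 * (j%:R^-1 * (p - j)%:R^-1) :> rat.
  by rewrite pjE; field; apply/andP.
by rewrite pdvd_exp // rpredM.
Qed.

Lemma harm_odd2 : pcong p 2 (harm_odd 2) (harm_even 2 + 2 * p%:R * E3).
Proof.
rewrite /harm_odd sum_odd_rev mulr_sumr -big_split /=.
by apply: pcong_sum => e; rewrite mem_index_iota => ep _; apply: inv_sq_refl.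
Qed.

Lemma harm_odd3 : pcong p 1 (harm_odd 3) (- E3).
Proof.
rewrite /harm_odd sum_odd_rev -sumrN; apply: pcong_sum => e.
rewrite mem_index_iota => ep _; have [ei pei _ _ _] := pint_refl_inv ep.
have r1 := inv_refl ep; rewrite -!exprVn.
have -> : - (e%:R^-1 ^+ 3) = - e%:R^-1 * (- e%:R^-1 * - e%:R^-1) :> rat by ring.
rewrite !exprS expr0 mulr1.
by do 2?[apply: pcongM; rewrite ?rpredM ?rpredN //].
Qed.

(** Case f(j) = j^-2 of [halving]: a = 2 comes from [inv_sq_refl], and l = 1/4 makes 4l exactly
    1. *)
Lemma harm2_pcong : pcong p 2 (3 * \sum_(1 <= j < p) j%:R ^- 2) (- (8 * p%:R * E3)).
Proof.
have -> : 8 * p%:R * E3 = 4 * 2 * p%:R * E3 by ring.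
apply: (@halving _ _ (1 / 4)); rewrite ?rpred_nat //.
- by rewrite div1r pintV.
- by move=> j jp; rewrite -exprVn rpredX // pintV.
- exact: inv_sq_refl.
- move=> j; rewrite natrM exprMn invfM; congr (_ * _).
- by apply: eq_pcong; field.
Qed.

(** The sum and the difference of the odd and even parts are both known, which determines twice the
    odd part. *)
Lemma harm_odd2_pcong : pcong p 2 (3 * harm_odd 2) (- (p%:R * E3)).
Proof.
have h2 := harm2_pcong; have o2 := harm_odd2; rewrite /pcong.
rewrite (bigID odd) /= -/(harm_even 2) -/(harm_odd 2) in h2.
apply: (@pdvd_cancel _ 2); first by lia.
have -> : 2 * (3 * harm_odd 2 - - (p%:R * E3)) =
  3 * (harm_odd 2 + harm_even 2) - - (8 * p%:R * E3)
   + 3 * (harm_odd 2 - (harm_even 2 + 2 * p%:R * E3)) by ring.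
by apply: pdvdD => //; rewrite pdvdMl ?rpred_nat.
Qed.

Lemma pcong_expB m j : (j < p)%N ->
  pcong p 2 ((p - j)%:R ^+ m.+1) ((- j%:R) ^+ m.+1 + m.+1%:R * p%:R * (- j%:R) ^+ m).
Proof.
move=> jp; rewrite natrB 1?ltnW // addrC.
elim: m => [|m IH]; first by apply: eq_pcong; rewrite !expr1 expr0; ring.
rewrite exprS; apply: (@pcong_trans _ _ ((- j%:R + p%:R) *
  ((- j%:R) ^+ m.+1 + m.+1%:R * p%:R * (- j%:R) ^+ m))).
  by apply: pcongMl => //; rewrite rpredD ?rpredN ?rpred_nat.
rewrite /pcong (_ : _ - _ = p%:R ^+ 2 * (m.+1%:R * (- j%:R) ^+ m)); last first.
  by rewrite -[m.+2%:R]natr1 !exprS expr0; ring.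
by rewrite pdvd_exp // rpredM ?rpredX ?rpredN ?rpred_nat.
Qed.

(** Case f(j) = j^(p-3) of [halving]. The exponent is even and is -3 modulo p, and j^(p-4) is j^-3
    modulo p by Fermat, whence a = 3; also 4l = 2^(p-1). The power sum is p B_(p-3) modulo p^2, so
    one factor p is cancelled at the end. *)
Lemma bernoulli_pcong : pcong p 1 (bernoulli (p - 3)) (- (4 * E3)).
Proof.
have [q pE] : exists q, p = q.+4 by exists (p - 4)%N; lia.
have P3 : (p - 3 = q.+1)%N by lia.
have oq : odd q = true by have := prime_gt3_odd p_prime p_gt3; rewrite pE /= !negbK.
pose W : rat := \sum_(1 <= j < p) j%:R ^+ q.+1.
have WB : pcong p 2 W (p%:R * bernoulli q.+1).
  have := @sum_powers_bernoulli q.+1; rewrite big_ltn ?expr0n ?add0r; last by lia.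
  by apply; lia.
have W3 : pcong p 2 (3 * W) (- (4 * 3 * p%:R * E3)).
  apply: (@halving _ _ (2 ^+ q.+1)); rewrite ?rpredX ?rpred_nat //.
  - by move=> j _; rewrite rpredX ?rpred_nat.
  - move=> j jp; have [ji pji j0 pj0 pjE] := pint_refl_inv jp.
    have jltp : (j < p)%N by lia.
    apply: pcong_trans (pcong_expB q jltp) _.
    rewrite !(exprNn j%:R) -(signr_odd _ q.+1) -(signr_odd _ q) /= oq expr0 expr1.
    have -> : q.+1%:R = p%:R - 3 :> rat by rewrite -P3 natrB 1?ltnW.
    have jF : pdvd p 1 (j%:R ^+ q * j%:R ^+ 3 - 1).
      by rewrite -exprD (_ : (q + 3 = p - 1)%N); [exact: fermat_pcong | lia].
    rewrite /pcong (_ : _ - _ = p%:R * (3 * ((j%:R ^+ q * j%:R ^+ 3 - 1) * j%:R^-1 ^+ 3))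
       - p%:R ^+ 2 * j%:R ^+ q); last first.
      by rewrite !mulN1r !exprS !expr0; field.
    apply: pdvdD; last by rewrite pdvdN pdvd_exp // rpredX ?rpred_nat.
    apply: (@pdvdM _ 1 1); first by rewrite -[p%:R]mulr1 -[p%:R]expr1 pdvd_exp ?rpred1.
    by rewrite pdvdMl ?rpred_nat // pdvdMr // rpredX.
  - by move=> j; rewrite natrM exprMn.
  - have -> : 4 * 2 ^+ q.+1 = 2%:R ^+ (p - 1) :> rat.
      by rewrite pE subn1 /= !exprS; ring.
    by apply: fermat_pcong; lia.
rewrite P3 /pcong; apply: (@pdvd_cancel _ 3) => //; apply: pdvd_cancelp.
have -> : p%:R * (3 * (bernoulli q.+1 - - (4 * E3))) =
   3 * W - - (4 * 3 * p%:R * E3) - 3 * (W - p%:R * bernoulli q.+1) by ring.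
by apply: pdvdD => //; rewrite pdvdN pdvdMl ?rpred_nat.
Qed.

End Prime.

(** * An alternating double sum *)

Definition dsum (p : nat) (F : nat -> nat -> rat) : rat :=
  \sum_(1 <= d < p) \sum_(1 <= j < d) F j d.

Lemma dsum_mkcond p F : dsum p F =
  \sum_(1 <= d < p) \sum_(1 <= j < p) (if (j < d)%N then F j d else 0).
Proof.
apply: eq_big_nat => d /andP[_ dp].
by rewrite (big_nat_widen _ _ p) ?(ltnW dp) // big_mkcond.
Qed.

(** The map (j, d) -> (p - d, p - j) permutes the triangle 0 < j < d < p. *)
Lemma dsum_reflect p F : dsum p F = dsum p (fun j d => F (p - d)%N (p - j)%N).
Proof.
rewrite !dsum_mkcond sum_rev; under eq_bigr do rewrite sum_rev.
rewrite exchange_big_nat; apply: eq_big_nat => d dp; apply: eq_big_nat => j jp.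
by congr (if _ then _ else _); lia.
Qed.

Lemma dsum_total p F : \sum_(1 <= j < p) \sum_(1 <= d < p) F j d =
  dsum p F + dsum p (fun j d => F d j) + \sum_(1 <= j < p) F j j.
Proof.
rewrite /dsum; elim: p => [|[|p] IH]; [by rewrite !big_geq ?addr0 | by rewrite !big_geq ?addr0 |].
have recr (G : nat -> rat) : \sum_(1 <= j < p.+2) G j = \sum_(1 <= j < p.+1) G j + G p.+1.
  by rewrite big_nat_recr.
rewrite recr; under eq_bigr do rewrite recr.
rewrite big_split /= IH !recr; ring.
Qed.

Lemma dsum_convolution p (G : nat -> nat -> rat) :
  \sum_(1 <= j < p) \sum_(1 <= k < p - j) G j k = dsum p (fun j d => G j (d - j)%N).
Proof.
rewrite dsum_mkcond exchange_big_nat; apply: eq_big_nat => j _.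
rewrite -big_mkcond -(big_nat_widenl j.+1 1 p xpredT) // -[j.+1]add1n big_addn.
by apply: eq_bigr => k _; rewrite addnK.
Qed.

Section Alternating.
Variable p : nat.
Hypotheses (p_prime : prime p) (p_gt3 : (3 < p)%N).

Let p_gt1 : (1 < p)%N. Proof. exact: prime_gt1. Qed.

Lemma dsum_pcong m F G :
  (forall j d, (0 < j < d)%N -> (d < p)%N -> pcong p m (F j d) (G j d)) ->
  pcong p m (dsum p F) (dsum p G).
Proof.
move=> FG; apply: pcong_sum => d; rewrite mem_index_iota => /andP[_ dp] _.
by apply: pcong_sum => j; rewrite mem_index_iota => jd _; apply: FG.
Qed.

(** By reflection the triangle sum agrees modulo p with its transpose. The two triangles and the
    diagonal fill the square, whose sum vanishes modulo p. *)
Lemma dsum_symm F :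
  (forall j d, (0 < j < d)%N -> (d < p)%N ->
     pcong p 1 (F (p - d)%N (p - j)%N) (F d j)) ->
  pdvd p 1 (\sum_(1 <= j < p) \sum_(1 <= d < p) F j d) ->
  pcong p 1 (2 * dsum p F) (- \sum_(1 <= j < p) F j j).
Proof.
move=> /dsum_pcong; rewrite -dsum_reflect => FF; rewrite dsum_total => tot.
rewrite /pcong (_ : _ - _ = (dsum p F - dsum p (fun j d => F d j)) +
  (dsum p F + dsum p (fun j d => F d j) + \sum_(1 <= j < p) F j j)); last by ring.
exact: pdvdD.
Qed.

Lemma sign_refl j : (j < p)%N -> (-1) ^+ (p - j) = - (-1) ^+ j :> rat.
Proof.
move=> jp; rewrite -signr_odd oddB ?(ltnW jp) // prime_gt3_odd //=.
by rewrite -[in RHS]signr_odd; case: (odd j); rewrite ?expr0 ?expr1 ?opprK.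
Qed.

Lemma harm1_pdvd : pdvd p 1 (\sum_(1 <= j < p) j%:R^-1).
Proof.
apply: (pdvd_cancel p_prime p_gt3 (b := 2)); first by lia.
rewrite mulr_natl mulr2n {1}sum_rev -big_split /= .
apply: pdvd_sum => j; rewrite mem_index_iota => jp _.
by have := inv_refl p_prime p_gt3 jp; rewrite /pcong opprK.
Qed.

Lemma harm2_pdvd : pdvd p 1 (\sum_(1 <= j < p) j%:R ^- 2).
Proof.
apply: (pdvd_cancel p_prime p_gt3 (b := 3)) => //.
apply: (pcong_pdvd (pcongW p_gt1 _ (harm2_pcong p_prime p_gt3))) => //.
rewrite pdvdN mulrAC mulrC -[p%:R]expr1 pdvd_exp // rpredM ?rpred_nat //.
rewrite -pdvd0; apply: pdvd_sum => j; rewrite mem_index_iota pdvd0 => jM _.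
by rewrite -exprVn rpredX // pintV.
Qed.

(** Harmonic double sums of depth two and weight three; [a] and [b] put a sign, or none, on j and on
    d. *)
Definition alt (a b : nat -> rat) := dsum p (fun j d => a j * b d / (j%:R * d%:R ^+ 2)).
Definition sgn (j : nat) : rat := (-1) ^+ j.
Definition one (j : nat) : rat := 1.
Notation E3 := (harm_even p 3).

Lemma alt_sum3 : pcong p 1 (\sum_(1 <= j < p) sgn j / j%:R ^+ 3) (2 * E3).
Proof.
rewrite (bigID odd) /=.
have -> : \sum_(1 <= j < p | odd j) sgn j / j%:R ^+ 3 = - harm_odd p 3.
  rewrite -sumrN; apply: eq_bigr => j oj.
  by rewrite /sgn -signr_odd oj expr1 mulN1r.
have -> : \sum_(1 <= j < p | ~~ odd j) sgn j / j%:R ^+ 3 = E3.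
  apply: eq_bigr => j /negbTE oj.
  by rewrite /sgn -signr_odd oj expr0 mul1r.
rewrite mulr_natl mulr2n; apply: pcongD; last exact: pcong_refl.
by rewrite -[X in pcong _ _ _ X]opprK; apply: pcongN; apply: harm_odd3.
Qed.

Lemma sgn_pint j : sgn j \is a pint p.
Proof. by rewrite rpredX // rpredN rpred1. Qed.

Lemma alt_refl j d : (0 < j < d)%N -> (d < p)%N ->
  pcong p 1 ((p - d)%:R^-1 * (p - j)%:R^-1 ^+ 2) (- (d%:R^-1 * j%:R^-1 ^+ 2)).
Proof.
move=> /andP[j0 jd] dp.
have jp : (0 < j < p)%N by lia.
have {jd} dp' : (0 < d < p)%N by lia.
have [ji pji _ _ _] := pint_refl_inv p_prime p_gt3 jp.
have [di pdi _ _ _] := pint_refl_inv p_prime p_gt3 dp'.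
have rj := inv_refl p_prime p_gt3 jp; have rd := inv_refl p_prime p_gt3 dp'.
have -> : - (d%:R^-1 * j%:R^-1 ^+ 2) = - d%:R^-1 * (- j%:R^-1 * - j%:R^-1) :> rat by ring.
rewrite expr2.
by do 2?[apply: pcongM; rewrite ?rpredM ?rpredN //].
Qed.

(** Reflection turns 1/(j d^2) into -1/(d j^2) modulo p, and the minus sign is offset by that of the
    first hypothesis, so [dsum_symm] applies. The square sum factors as in the third hypothesis, and
    the diagonal is the sum of (-1)^j / j^3, which is 2 E_3. *)
Lemma alt_self_dual a b :
  (forall j d, (0 < j < d)%N -> (d < p)%N -> a (p - d)%N * b (p - j)%N = - (a d * b j)) ->
  (forall j d, a d * b j \is a pint p) ->
  pdvd p 1 ((\sum_(1 <= j < p) a j / j%:R) * \sum_(1 <= d < p) b d / d%:R ^+ 2) ->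
  (forall j, a j * b j = sgn j) ->
  pcong p 1 (alt a b) (- E3).
Proof.
move=> ab abp tot abs.
have E a' x y : a' / (x * y ^+ 2) = a' * (x^-1 * y^-1 ^+ 2) :> rat.
  by rewrite invfM exprVn.
have two0 : 2 != 0 :> rat by [].
rewrite -[alt _ _](mulKf two0) -[X in pcong _ _ _ X](mulKf two0).
apply: pcongMl; first by apply: pintV => //; lia.
apply: pcong_trans (dsum_symm _ _) _.
- move=> j d jd dp; rewrite ab // !E mulNr -mulrN; apply: pcongMl => //.
  by rewrite -[X in pcong _ _ _ X]opprK; apply: pcongN; apply: alt_refl.
- rewrite big_distrlr /= in tot.
  move: tot; congr (pdvd _ _ _); apply: eq_bigr => j _; apply: eq_bigr => d _.
  by rewrite invfM mulrACA.
- rewrite mulrN; apply: pcongN.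
  apply: pcong_trans _ alt_sum3; apply: eq_pcong; apply: eq_bigr => j _.
  by rewrite abs -exprS.
Qed.

(** The square sum vanishes modulo p through its factor with terms 1/d^2. *)
Lemma alt_sgn_one : pcong p 1 (alt sgn one) (- E3).
Proof.
apply: alt_self_dual => [j d /andP[j0 jd] dp|j d||j]; rewrite /one ?mulr1 ?sgn_pint //.
  by rewrite /sgn sign_refl.
apply: pdvdMl; last by under eq_bigr do rewrite mul1r; apply: harm2_pdvd.
rewrite -pdvd0; apply: pdvd_sum => j; rewrite mem_index_iota pdvd0 => jp _.
by rewrite rpredM ?sgn_pint ?pintV.
Qed.

(** The square sum vanishes modulo p through its factor with terms 1/j. *)
Lemma alt_one_sgn : pcong p 1 (alt one sgn) (- E3).
Proof.
apply: alt_self_dual => [j d /andP[j0 jd] dp|j d||j]; rewrite /one ?mul1r ?sgn_pint //.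
  by rewrite /sgn sign_refl //; lia.
apply: pdvdMr; first by under eq_bigr do rewrite mul1r; apply: harm1_pdvd.
rewrite -pdvd0; apply: pdvd_sum => j; rewrite mem_index_iota pdvd0 => jp _.
by rewrite -exprVn rpredM ?sgn_pint // rpredX // pintV.
Qed.

(* Reflecting k -> p - j - k in the sum of (-1)^k / (j k (j + k)) over j + k < p, and
   expanding both sides by 1/(j k) = (1/j + 1/k) / (j + k), relates the three sums. *)
Lemma alt_sgn_sgn : pcong p 1 (alt sgn sgn) (3 * E3).
Proof.
have conv F : dsum p F = dsum p (fun j d => F (d - j)%N d).
  by apply: eq_big_nat => d _; rewrite sum_rev.
have parfrac (c : rat) (j d : nat) : (0 < j < d)%N ->
  c / (j%:R * (d - j)%:R * (j + (d - j))%:R) =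
  c / (j%:R * d%:R ^+ 2) + c / ((d - j)%:R * d%:R ^+ 2).
  move=> /andP[j0 jd]; have j1 : 0 < j%:R :> rat by rewrite ltr0n.
  have d1 : j%:R < d%:R :> rat by rewrite ltr_nat.
  rewrite subnKC 1?ltnW // natrB 1?ltnW //.
  by field; repeat (apply/andP; split); lra.
pose G1 j k : rat := sgn k / (j%:R * k%:R * (j + k)%:R).
pose G2 j k : rat := sgn (j + k) / (j%:R * k%:R * (j + k)%:R).
have E1 : dsum p (fun j d => G1 j (d - j)%N) = alt sgn one + alt sgn sgn.
  rewrite [alt sgn one]conv /alt /dsum -big_split /=.
  apply: eq_big_nat => d _; rewrite -big_split /=; apply: eq_big_nat => j jd.
  have -> : sgn d = sgn (d - j) * sgn j.
    by rewrite /sgn -exprD subnK // ltnW //; case/andP: jd.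
  rewrite /G1 parfrac // /one mulr1 addrC; congr (_ + _ / _).
  by congr (_ / _); rewrite mulrCA /sgn -exprMn mulrNN mulr1 expr1n mulr1.
have E2 : dsum p (fun j d => G2 j (d - j)%N) = 2 * alt one sgn.
  rewrite mulr_natl mulr2n [X in _ = _ + X]conv /alt /dsum -big_split /=.
  apply: eq_big_nat => d _; rewrite -big_split /=; apply: eq_big_nat => j jd.
  by rewrite /G2 parfrac // /one mul1r subnKC // ltnW //; case/andP: jd.
have E12 : pcong p 1 (alt sgn one + alt sgn sgn) (- (2 * alt one sgn)).
  rewrite -E1 -E2 -!dsum_convolution -sumrN.
  apply: pcong_sum => j; rewrite mem_index_iota => jp _.
  rewrite sum_rev -sumrN; apply: pcong_sum => k; rewrite mem_index_iota => kp _.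
  have jkp : (0 < j + k < p)%N by lia.
  have kp' : (0 < k < p)%N by lia.
  have [ji _ _ _ _] := pint_refl_inv p_prime p_gt3 jp.
  have [ki pki _ _ _] := pint_refl_inv p_prime p_gt3 kp'.
  have [jki pjki _ _ _] := pint_refl_inv p_prime p_gt3 jkp.
  rewrite /G1 /G2 -subnDA (_ : j + (p - (j + k)) = p - k)%N; last by lia.
  rewrite /sgn sign_refl -/(sgn _); last by lia.
  rewrite mulNr; apply: pcongN; apply: pcongMl; first exact: sgn_pint.
  rewrite !invfM -!mulrA; apply: pcongMl => //.
  have -> : k%:R^-1 * (j + k)%:R^-1 = - (j + k)%:R^-1 * - k%:R^-1 :> rat by ring.
  by apply: pcongM; rewrite ?rpredN //; apply: inv_refl.
have h1 := alt_sgn_one; have h2 := alt_one_sgn; rewrite /pcong.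
have -> : alt sgn sgn - 3 * E3 = (alt sgn one + alt sgn sgn - - (2 * alt one sgn))
   - (alt sgn one - - E3) - 2 * (alt one sgn - - E3) by ring.
by apply: pdvdD; rewrite ?pdvdN ?pdvdMl ?rpred_nat //; apply: pdvdD; rewrite ?pdvdN.
Qed.

(** The weight (1 - (-1)^d) / 2 selects the odd d, so the sum is half of
    [alt sgn one - alt sgn sgn], that is (-E_3 - 3 E_3) / 2. *)
Lemma alt_odd : pcong p 1
  (\sum_(1 <= d < p | odd d) (\sum_(1 <= j < d) sgn j / j%:R) / d%:R ^+ 2) (- (2 * E3)).
Proof.
apply: (pdvd_cancel p_prime p_gt3 (b := 2)); first by lia.
have h1 := alt_sgn_one; have h2 := alt_sgn_sgn.
have -> : 2 * (\sum_(1 <= d < p | odd d) (\sum_(1 <= j < d) sgn j / j%:R) / d%:R ^+ 2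
    - - (2 * E3)) = alt sgn one - - E3 - (alt sgn sgn - 3 * E3).
  suff -> : \sum_(1 <= d < p | odd d) (\sum_(1 <= j < d) sgn j / j%:R) / d%:R ^+ 2
    = (alt sgn one - alt sgn sgn) / 2 by field.
  rewrite /alt /dsum -sumrB mulr_suml big_mkcond; apply: eq_bigr => d _.
  rewrite -sumrB; case: ifP => od.
    rewrite !mulr_suml; apply: eq_bigr => j _.
    rewrite /one -[sgn d]signr_odd od expr1 -[LHS]mulrA -invfM mulr1 mulrN1 mulNr opprK.
    by move: (_ / _) => x; field.
  rewrite big1 ?mul0r // => j _.
  by rewrite /one [in sgn d]/sgn -signr_odd od expr0 subrr.
by apply: pdvdD; rewrite ?pdvdN.
Qed.
End Alternating.

(** * Conclusion *)

Section Assembly.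
Variable p : nat.
Hypotheses (p_prime : prime p) (p_gt3 : (3 < p)%N).

Let p_gt1 : (1 < p)%N. Proof. exact: prime_gt1. Qed.
Notation E3 := (harm_even p 3).

Let D : rat := \sum_(1 <= d < p | odd d) (\sum_(1 <= j < d) sgn j / j%:R) / d%:R ^+ 2.

Lemma tail_sumE : tail_sum p = p%:R ^+ 2 * harm_odd p 2 - p%:R ^+ 3 * harm_odd p 3
  + 2 * p%:R ^+ 3 * D.
Proof.
rewrite /tail_sum /harm_odd /D !mulr_sumr -sumrB -big_split /=.
apply: eq_bigr => d _; rewrite !expr_div_n; congr (_ + _).
rewrite mulr_suml !mulr_sumr; apply: eq_bigr => j _.
by rewrite /sgn !exprS expr0 !mulr1; ring.
Qed.

Lemma harm_pint k (P : pred nat) :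
  \sum_(1 <= j < p | P j) j%:R ^- k \is a pint p.
Proof.
rewrite -pdvd0; apply: pdvd_sum => j; rewrite mem_index_iota pdvd0 => jp _.
by rewrite -exprVn rpredX // pintV.
Qed.

(** Since 3 O_2 is -p E_3 modulo p^2, O_2 is divisible by p and every term of the tail has order 3.
    The factor 6 avoids the denominators of 7/6. *)
Lemma tail_sum_value : pdvd p 3 (tail_sum p) /\
  pcong p 4 (6 * (1 + 2 * \sum_(1 <= e < p | ~~ odd e) (p%:R / e%:R) ^+ 3 + 2 * tail_sum p))
   (6 + 7 * p%:R ^+ 3 * bernoulli (p - 3)).
Proof.
have E3p : E3 \is a pint p by apply: harm_pint.
have O3p : harm_odd p 3 \is a pint p by apply: harm_pint.
have hO2 := harm_odd2_pcong p_prime p_gt3.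
have hO3 := harm_odd3 p_prime p_gt3.
have hD : pcong p 1 D (- (2 * E3)) := alt_odd p_prime p_gt3.
have hB := bernoulli_pcong p_prime p_gt3.
have Dp : D \is a pint p.
  by apply: (pcong_pint p_gt1 hD); rewrite rpredN rpredM ?rpred_nat.
rewrite tail_sumE; split.
  apply: pdvdD; last first.
    by rewrite -mulrA pdvdMl ?rpred_nat // pdvd_exp.
  apply: pdvdD; last by rewrite pdvdN pdvd_exp.
  apply: (@pdvdM _ 2 1); first by rewrite -[_ ^+ 2]mulr1 pdvd_exp ?rpred1.
  apply: (pdvd_cancel p_prime p_gt3 (b := 3)) => //.
  apply: (pcong_pdvd (pcongW p_gt1 _ hO2)) => //.
  by rewrite pdvdN -{1}[p%:R]expr1 pdvd_exp.
have -> : \sum_(1 <= e < p | ~~ odd e) (p%:R / e%:R) ^+ 3 = p%:R ^+ 3 * E3.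
  by rewrite mulr_sumr; apply: eq_bigr => e _; rewrite expr_div_n.
rewrite /pcong in hO2 hO3 hD hB *.
set P := p%:R; rewrite -/P in hO2.
have pX m : pdvd p m (P ^+ m) by rewrite -[P ^+ m]mulr1 pdvd_exp ?rpred1.
(* The coefficient of p^3 E_3 is 12 - 4 + 12 - 48 = -28, with contributions from E_3, O_2, O_3 and D
   in this order, and -28 E_3 is 7 B_(p-3) modulo p. *)
rewrite (_ : _ - _ = P ^+ 2 * (4 * (3 * harm_odd p 2 - - (P * E3)))
  - P ^+ 3 * (12 * (harm_odd p 3 - - E3) - 24 * (D - - (2 * E3))
     + 7 * (bernoulli (p - 3) - - (4 * E3)))); last by ring.
apply: pdvdD; first by apply: (@pdvdM _ 2 2) => //; rewrite pdvdMl ?rpred_nat.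
rewrite pdvdN; apply: (@pdvdM _ 3 1) => //.
apply: pdvdD; last by rewrite pdvdMl ?rpred_nat.
by apply: pdvdD; rewrite ?pdvdN; rewrite pdvdMl ?rpred_nat.
Qed.

End Assembly.

Theorem theorem1p2 (p r : nat) :
  prime p -> (3 < p)%N -> (1 <= r)%N ->
  rat_cong
    (\sum_(0 <= k < ((p ^ r - 1) %/ 2).+1)
        (4 * k%:R + 1) * (pochhammer (1 / 2) k ^+ 4 / pochhammer 1 k ^+ 4))
    ((p ^ r)%:R + 7 / 6 * (p ^ (r + 3))%:R * bernoulli (p - 3))
    p (r + 4).
Proof.
move=> p_prime p_gt3; case: r => // r _.
have p_gt1 := prime_gt1 p_prime.
pose N := ((p ^ r.+1 - 1) %/ 2)%N; rewrite -/N.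
have nE : (p ^ r.+1 = 2 * N + 1)%N.
  have : odd (p ^ r.+1) by rewrite oddX prime_gt3_odd.
  by rewrite /N; lia.
have [psum3 psumV] := tail_sum_value p_prime p_gt3.
have [X SE SX] := quartic_sum_reduction p_prime p_gt3 nE psum3.
(* For prime p, a denominator not divisible by p is one coprime to p, so the goal becomes a [pdvd]
   statement. *)
rewrite /rat_cong -prime_coprime //.
rewrite (_ : \sum_(0 <= k < N.+1) _ = (p ^ r.+1)%:R * X); last first.
  by rewrite -SE; apply: eq_bigr => k _; rewrite /cpoch expr_div_n.
rewrite (natrX _ p (r.+1 + 4)) -[coprime _ _]/(pdvd p (r.+1 + 4) (_ - _)).
rewrite (_ : _ - _ = (p ^ r.+1)%:R * (X - (1 + 7 / 6 * p%:R ^+ 3 * bernoulli (p - 3))));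
  last by rewrite expnD natrM !natrX; ring.
apply: pdvdM; first by rewrite natrX -[_ ^+ _]mulr1 pdvd_exp ?rpred1.
(* Multiplying by 2 and by 3 clears the denominator of 7/6; both are prime to p as p > 3. *)
apply: (pdvd_cancel p_prime p_gt3 (b := 2)); first by lia.
apply: (pdvd_cancel p_prime p_gt3 (b := 3)) => //.
move: psumV SX; rewrite /pcong; set Y := _ + 2 * tail_sum p => YB XY.
rewrite (_ : 3 * _ = 6 * (X - Y) + (6 * Y - (6 + 7 * p%:R ^+ 3 * bernoulli (p - 3))));
  last by field.
by apply: pdvdD; rewrite // pdvdMl ?rpred_nat.
Qed.
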